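(* For a UC family $\mathcal{A}$ with $U(\mathcal{A})=[n]$ and $\emptyset\in\mathcal{A}$, write $\mathcal{B}^{(j)}=\mathcal{P}([n]\setminus\{j\})\uplus\mathcal{A}$ for $j\in[n]$. The existence of $y\in\mathbb{R}_{\ge0}^n$ with $\sum_{i\in[n]}y_i\le1$ and $$\sum_{i\in[n]}y_i|\mathcal{B}^{(j)}_i|=|\mathcal{B}^{(j)}|/2\quad\text{for all }j\in[n]$$ does not necessarily imply that $P^{\mathcal{A}}$ is nonempty. That is, there exist $n\ge1$ and a UC family $\mathcal{A}$ with $U(\mathcal{A})=[n]$ and $\emptyset\in\mathcal{A}$ for which such a $y$ exists but $P^{\mathcal{A}}=\emptyset$.
   Context: A UC (union-closed) family is a nonempty finite family $\mathcal{F}$ of distinct finite sets such that $A\cup B\in\mathcal{F}$ for all $A,B\in\mathcal{F}$. $[n]=\{1,\dots,n\}$, $\mathcal{P}([n])$ is its power set, $U(\mathcal{F})$ is the union of all sets in $\mathcal{F}$, $\mathcal{F}_i=\{F\in\mathcal{F} : i\in F\}$, and $\mathcal{A}\uplus\mathcal{B}=\{A\cup B : A\in\mathcal{A},B\in\mathcal{B}\}$. $P^{\mathcal{A}}$ is the polyhedron of all $y\in\mathbb{R}^n$ with $y_i\ge0$ for all $i\in[n]$, $\sum_{i\in[n]}y_i=1$, and $\sum_{i\in[n]}y_i|\mathcal{B}_i|\ge|\mathcal{B}|/2$ for every UC family $\mathcal{B}\subseteq\mathcal{P}([n])$ with $\mathcal{B}\uplus\mathcal{A}=\mathcal{B}$.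 *)

(* Defs.v *)
From HB Require Import structures.
From mathcomp Require Import all_boot all_order all_algebra.
From mathcomp Require Import classical_sets reals.

Set Implicit Arguments.
Unset Strict Implicit.
Unset Printing Implicit Defensive.

Import GRing.Theory Num.Theory.

Local Open Scope ring_scope.

(* The ground set [n] = {1, ..., n} is encoded as the type 'I_n, so that a
   family of subsets of [n] is a term of type {set {set 'I_n}}. *)

Definition UC n (F : {set {set 'I_n}}) : Prop :=
  F != finset.set0 /\
  forall A B : {set 'I_n}, A \in F -> B \in F -> A :|: B \in F.

Definition uplus n (F G : {set {set 'I_n}}) : {set {set 'I_n}} :=
  [set A :|: B | A in F, B in G]%SET.

Definition containing n (F : {set {set 'I_n}}) (i : 'I_n) : {set {set 'I_n}} :=
  [set A in F | i \in A]%SET.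

Definition Bfam n (F : {set {set 'I_n}}) (j : 'I_n) : {set {set 'I_n}} :=
  uplus (powerset ([set: 'I_n] :\ j)%SET) F.

Definition polyhedron (R : realType) n (F : {set {set 'I_n}}) : set 'rV[R]_n :=
  [set y : 'rV[R]_n |
    [/\ forall i : 'I_n, 0 <= y ord0 i,
        \sum_(i < n) y ord0 i = 1
      & forall B : {set {set 'I_n}}, UC B -> uplus B F = B ->
          \sum_(i < n) y ord0 i * #|containing B i|%:R >= #|B|%:R / 2]]%classic.

Arguments polyhedron R {n} F.

(* Main.v *)
(* Counterexample on {0, ..., 6}, with T = {0, 1, 2} and C = {3, 4, 5, 6}: let A
   be generated by {3,4,6}, {4,5,6}, T+{4,5}, T+{3,6}, T+{4,6} and the empty set.
   Every member of A contains T or misses it, so for t in T the family of all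
   sets meeting T in {}, {t} or T is A-closed; it forces y_t >= y_u + y_v for
   {t,u,v} = T, hence y vanishes on T.  These constraints are invisible to the
   equations of the families B^(j), whose solution is positive on T with sum
   3817/3818; but once y vanishes on T, the B^(j) with j in C make it vanish on
   C too, which contradicts sum y = 1. *)
Require Import Defs.
From mathcomp Require Import all_boot all_order all_algebra.
From mathcomp Require Import classical_sets reals.
From mathcomp Require Import lra.

Import boot.finset GRing.Theory Num.Theory.

Local Open Scope ring_scope.

(** * Families of subsets as lists of bit sequences *)

Section Masks.
Local Open Scope nat_scope.
Local Open Scope set_scope.
Variable n : nat.
Implicit Types (S : {set 'I_n}) (s t : bitseq) (L M : seq bitseq).

(* {set 'I_n} does not reduce, so families are evaluated on bit sequences. *)
Definition mask_of S : bitseq := [seq i \in S | i <- enum 'I_n].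

Definition set_of s : {set 'I_n} := [set i : 'I_n | nth false s i].

Definition orb_seq s t : bitseq := [seq x.1 || x.2 | x <- zip s t].

Definition mask_family L : {set {set 'I_n}} := [set S | mask_of S \in L].

Definition masks L := all (fun s => size s == n) L.

Lemma size_mask_of S : size (mask_of S) = n.
Proof. by rewrite size_map size_enum_ord. Qed.

Lemma nth_mask_of S (i : 'I_n) : nth false (mask_of S) i = (i \in S).
Proof. by rewrite (nth_map i) ?size_enum_ord // nth_ord_enum. Qed.

Lemma mask_ofK : cancel mask_of set_of.
Proof. by move=> S; apply/setP=> i; rewrite inE nth_mask_of. Qed.

Lemma set_ofK s : size s = n -> mask_of (set_of s) = s.
Proof.
move=> sn; apply: (@eq_from_nth _ false); rewrite size_mask_of ?sn // => i ltin.
by rewrite (nth_mask_of _ (Ordinal ltin)) inE.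
Qed.

Lemma mask_of0 : mask_of set0 = nseq n false.
Proof.
apply: (@eq_from_nth _ false); rewrite size_mask_of ?size_nseq // => i ltin.
by rewrite (nth_mask_of _ (Ordinal ltin)) inE nth_nseq ltin.
Qed.

Lemma mask_ofT : mask_of setT = nseq n true.
Proof.
apply: (@eq_from_nth _ false); rewrite size_mask_of ?size_nseq // => i ltin.
by rewrite (nth_mask_of _ (Ordinal ltin)) inE nth_nseq ltin.
Qed.

Lemma mask_ofU S S' : mask_of (S :|: S') = orb_seq (mask_of S) (mask_of S').
Proof.
by rewrite /mask_of /orb_seq; elim: (enum _) => //= i e ->; rewrite in_setU.
Qed.

Lemma set_of_mask_family L s : masks L -> s \in L ->
  set_of s \in mask_family L /\ mask_of (set_of s) = s.
Proof. by move=> /allP ML sL; rewrite inE set_ofK ?sL //; apply/eqP/ML. Qed.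
Arguments set_of_mask_family {L s}.

Lemma eq_mask_family L M : L =i M -> mask_family L = mask_family M.
Proof. by move=> eLM; apply/setP=> S; rewrite !inE eLM. Qed.

Lemma uplus_mask_family L M : masks L -> masks M ->
  uplus (mask_family L) (mask_family M) = mask_family [seq orb_seq s t | s <- L, t <- M].
Proof.
move=> mL mM; apply/setP=> S; rewrite [RHS]inE; apply/imset2P/allpairsP.
  case=> A B; rewrite !inE => AL BM ->.
  by exists (mask_of A, mask_of B); rewrite mask_ofU.
case=> -[s t] /= [sL tM eS].
have [sF es] := set_of_mask_family mL sL; have [tF et] := set_of_mask_family mM tM.
exists (set_of s) (set_of t) => //.
by apply: (can_inj mask_ofK); rewrite mask_ofU es et.
Qed.

Lemma containing_mask_family L (i : 'I_n) :
  containing (mask_family L) i = mask_family [seq s <- L | nth false s i].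
Proof. by apply/setP=> S; rewrite !inE mem_filter nth_mask_of andbC. Qed.

(** On sequences of length [n], [set_of] and [mask_of] are inverse to each other, so only
    repetitions in [L] separate its length from the cardinality. *)
Lemma card_mask_family L : masks L -> #|mask_family L| = size (undup L).
Proof.
move=> mL; rewrite cardE -(size_map mask_of); apply: perm_size.
apply: uniq_perm; rewrite ?undup_uniq ?(map_inj_uniq (can_inj mask_ofK)) ?enum_uniq //.
move=> s; rewrite mem_undup; apply/mapP/idP => [[S]|sL].
  by rewrite mem_enum inE => ? ->.
have [sF es] := set_of_mask_family mL sL.
by exists (set_of s) => //; rewrite mem_enum.
Qed.

(** Every hypothesis is a boolean that evaluates, so union-closedness of a concrete family is
    settled by computation. *)
Lemma UC_mask_family L : L != [::] -> masks L ->
  allrel (fun s t => orb_seq s t \in L) L L -> UC (mask_family L).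
Proof.
move=> L0 mL /allrelP UL; split=> [|A B]; last first.
  by rewrite !inE mask_ofU; apply: UL.
case: L L0 mL {UL} => // s L _ mL.
by apply/set0Pn; exists (set_of s); have [] := set_of_mask_family mL (mem_head s L).
Qed.

Lemma uplus_mask_family_id L M : nseq n false \in M ->
  allrel (fun s t => orb_seq s t \in L) L M ->
  uplus (mask_family L) (mask_family M) = mask_family L.
Proof.
move=> M0 /allrelP LM; apply/setP=> S; apply/imset2P/idP => [[A B]|SL].
  by rewrite !inE => AL BM ->; rewrite mask_ofU LM.
by exists S set0; rewrite ?setU0 // inE mask_of0.
Qed.

End Masks.

(** * Power sets and the families B^(j) as lists *)

Fixpoint bitseqs n : seq bitseq :=
  if n is m.+1 then [seq b :: s | b <- [:: false; true], s <- bitseqs m]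
  else [:: [::]].

Lemma mem_bitseqs n s : (s \in bitseqs n) = (size s == n).
Proof.
elim: n s => [|n IHn] s; first by case: s.
apply/allpairsP/idP => [[[b t]] /= [_ + ->] /= | ]; first by rewrite IHn.
case: s => // b s sn; exists (b, s); split=> //=; first by case: b {sn}.
by rewrite IHn.
Qed.

Lemma masks_bitseqs n (p : pred bitseq) : masks n (filter p (bitseqs n)).
Proof. by apply/allP=> s; rewrite mem_filter mem_bitseqs => /andP[]. Qed.

Lemma powerset_mask_family n (j : 'I_n) :
  powerset ([set: 'I_n] :\ j)%SET
  = mask_family n [seq s <- bitseqs n | ~~ nth false s j].
Proof.
apply/setP=> S; rewrite !inE mem_filter mem_bitseqs size_mask_of eqxx andbT.
by rewrite nth_mask_of subsetD1 subsetT.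
Qed.

(** Different pairs can have the same union; [undup] makes list lengths count sets. *)
Definition Bmasks n (L : seq bitseq) (j : nat) : seq bitseq :=
  undup [seq orb_seq s t | s <- [seq s <- bitseqs n | ~~ nth false s j], t <- L].

Lemma Bfam_mask_family n (L : seq bitseq) (j : 'I_n) : masks n L ->
  Bfam (mask_family n L) j = mask_family n (Bmasks n L j).
Proof.
move=> mL; rewrite /Bfam powerset_mask_family uplus_mask_family ?masks_bitseqs //.
by apply: eq_mask_family => s; rewrite mem_undup.
Qed.

(** * The families B^(j) are among those that constrain the polyhedron *)

Section Uplus.
Variables (n : nat) (F : {set {set 'I_n}}).
Hypothesis UF : UC F.
Local Open Scope set_scope.

Lemma UC_Bfam j : UC (Bfam F j).
Proof.
case: UF => /set0Pn[A0 FA0] closF; split=> [|S S'].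
  apply/set0Pn; exists (set0 :|: A0); apply/imset2P.
  by exists set0 A0; rewrite // powersetE sub0set.
case/imset2P=> X A + FA -> /imset2P[Y B + FB ->].
rewrite !powersetE => XP YP; rewrite setUACA; apply/imset2P.
by exists (X :|: Y) (A :|: B); rewrite ?powersetE ?subUset ?XP ?closF.
Qed.

(** Regrouping (X + A) + B as X + (A + B) gives one inclusion, as [F] is union-closed; adding the
    empty set gives the other. *)
Lemma uplus_Bfam j : set0 \in F -> uplus (Bfam F j) F = Bfam F j.
Proof.
case: UF => _ closF F0; apply/setP=> S; apply/imset2P/idP => [[S' B]|SB].
  case/imset2P=> X A XP FA -> FB ->; rewrite -setUA.
  by apply/imset2P; exists X (A :|: B); rewrite ?closF.
by exists S set0; rewrite ?setU0.
Qed.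

End Uplus.

(** * The counterexample and the test families on T *)

Definition Amasks : seq bitseq :=
  [seq [seq i \in l | i <- iota 0 7] | l <-
    [:: [::]; [:: 3; 4; 6]; [:: 4; 5; 6]; [:: 3; 4; 5; 6];
        [:: 0; 1; 2; 4; 5]; [:: 0; 1; 2; 3; 6]; [:: 0; 1; 2; 4; 6];
        [:: 0; 1; 2; 3; 4; 6]; [:: 0; 1; 2; 4; 5; 6];
        [:: 0; 1; 2; 3; 4; 5; 6]]]%N.

(* The sets meeting {0, 1, 2} in the empty set, in {t}, or in {0, 1, 2}. *)
Definition Tmasks (t : nat) : seq bitseq :=
  [seq s <- bitseqs 7 |
    take 3 s \in [:: nseq 3 false; mkseq (pred1 t) 3; nseq 3 true]].

Definition A7 := mask_family 7 Amasks.

Lemma masks_Amasks : masks 7 Amasks. Proof. by vm_compute. Qed.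

Lemma UC_A7 : UC A7.
Proof. by apply: UC_mask_family; [vm_compute | exact: masks_Amasks | vm_compute]. Qed.

Lemma set0_A7 : set0 \in A7.
Proof. by rewrite inE mask_of0; vm_compute. Qed.

Lemma cover_A7 : cover A7 = [set: 'I_7]%SET.
Proof.
(* The whole ground set is itself a member of [A7]. *)
apply/eqP; rewrite -subTset; apply: (@bigcup_sup _ _ setT).
by rewrite inE mask_ofT; vm_compute.
Qed.

Lemma UC_Tmasks t : (t < 3)%N -> UC (mask_family 7 (Tmasks t)).
Proof.
by case: t => [|[|[|t]]] // _;
  (apply: UC_mask_family; [vm_compute | exact: masks_bitseqs | vm_compute]).
Qed.

Lemma uplus_Tmasks t : (t < 3)%N ->
  uplus (mask_family 7 (Tmasks t)) A7 = mask_family 7 (Tmasks t).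
Proof.
by case: t => [|[|[|t]]] // _; (apply: uplus_mask_family_id; vm_compute).
Qed.

(** * Element counts, and the linear arithmetic on them *)

Definition occurrences (L : seq bitseq) (i : nat) : nat :=
  size [seq s <- L | nth false s i].

(** The counts are read off a closed list, which does not mention [i] and can thus be replaced by a
    precomputed table under the sum. *)
Lemma sum_containing_mask_family n (R : realType) (y : 'rV[R]_n) L :
  masks n L -> uniq L ->
  \sum_(i < n) y ord0 i * #|containing (mask_family n L) i|%:R
  = \sum_(i < n) y ord0 i * (nth 0%N (mkseq (occurrences L) n) i)%:R.
Proof.
move=> mL uL; apply: eq_bigr => i _; rewrite nth_mkseq //.
rewrite containing_mask_family card_mask_family ?undup_id ?filter_uniq //.
by apply/allP=> s; rewrite mem_filter => /andP[_ /(allP mL)].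
Qed.

Lemma uniq_bitseqs n : uniq (bitseqs n).
Proof.
elim: n => // n IHn; apply: (@allpairs_uniq _ _ _ cons) => //.
by move=> [b s] [c t] _ _ [-> ->].
Qed.

Lemma masks_Bmasks n (L : seq bitseq) j : masks n L -> masks n (Bmasks n L j).
Proof.
move=> /allP mL; rewrite /masks all_undup; apply/allP=> u.
case/allpairsP=> -[s t] /= [+ tL ->].
rewrite mem_filter mem_bitseqs => /andP[_ /eqP ss].
by rewrite size_map size_zip ss (eqP (mL _ tL)) minnn.
Qed.

Lemma sum_containing_Bfam n (R : realType) (y : 'rV[R]_n) L (j : 'I_n) :
  masks n L ->
  \sum_(i < n) y ord0 i * #|containing (Bfam (mask_family n L) j) i|%:R
  = \sum_(i < n) y ord0 i * (nth 0%N (mkseq (occurrences (Bmasks n L j)) n) i)%:R.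
Proof.
move=> mL; rewrite Bfam_mask_family // sum_containing_mask_family ?masks_Bmasks //.
exact: undup_uniq.
Qed.

Lemma card_Bfam n L (j : 'I_n) : masks n L ->
  #|Bfam (mask_family n L) j| = size (Bmasks n L j).
Proof.
move=> mL; rewrite Bfam_mask_family // card_mask_family ?masks_Bmasks // undup_id //.
exact: undup_uniq.
Qed.

Definition Bsizes : seq nat := [:: 72; 72; 72; 82; 91; 82; 91]%N.

(** Row [j], column [i] holds the number of members of B^(j) that contain [i]. *)
Definition Boccurrences : seq (seq nat) :=
  [:: [:: 8; 40; 40; 37; 38; 37; 38];
      [:: 40; 8; 40; 37; 38; 37; 38];
      [:: 40; 40; 8; 37; 38; 37; 38];
      [:: 42; 42; 42; 18; 48; 41; 50];
      [:: 47; 47; 47; 49; 27; 50; 57];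
      [:: 42; 42; 42; 41; 50; 18; 48];
      [:: 47; 47; 47; 50; 57; 49; 27]]%N.

Lemma BsizesE : mkseq (fun j => size (Bmasks 7 Amasks j)) 7 = Bsizes.
Proof. by vm_compute. Qed.

Lemma BoccurrencesE :
  mkseq (fun j => mkseq (occurrences (Bmasks 7 Amasks j)) 7) 7 = Boccurrences.
Proof. by vm_compute. Qed.

Lemma Bfam_counts (R : realType) (y : 'rV[R]_7) (j : 'I_7) :
  #|Bfam A7 j| = nth 0%N Bsizes j /\
  \sum_(i < 7) y ord0 i * #|containing (Bfam A7 j) i|%:R
  = \sum_(i < 7) y ord0 i * (nth 0%N (nth [::] Boccurrences j) i)%:R.
Proof.
rewrite (card_Bfam _ _ _ masks_Amasks) (sum_containing_Bfam _ _ _ _ _ masks_Amasks).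
by rewrite -BsizesE -BoccurrencesE !nth_mkseq.
Qed.

(** Three traces on T times 16 subsets of C give 48 sets: [t] lies in two traces, the rest of T in
    one, and each element of C in half of the sets. *)
Definition Toccurrences : seq (seq nat) :=
  [:: [:: 32; 16; 16; 24; 24; 24; 24];
      [:: 16; 32; 16; 24; 24; 24; 24];
      [:: 16; 16; 32; 24; 24; 24; 24]]%N.

Lemma TsizesE : mkseq (fun t => size (Tmasks t)) 3 = [:: 48; 48; 48]%N.
Proof. by vm_compute. Qed.

Lemma ToccurrencesE :
  mkseq (fun t => mkseq (occurrences (Tmasks t)) 7) 3 = Toccurrences.
Proof. by vm_compute. Qed.

Lemma Tmasks_counts (R : realType) (y : 'rV[R]_7) t : (t < 3)%N ->
  #|mask_family 7 (Tmasks t)| = nth 0%N [:: 48; 48; 48]%N t /\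
  \sum_(i < 7) y ord0 i * #|containing (mask_family 7 (Tmasks t)) i|%:R
  = \sum_(i < 7) y ord0 i * (nth 0%N (nth [::] Toccurrences t) i)%:R.
Proof.
have mT : masks 7 (Tmasks t) by exact: masks_bitseqs.
have uT : uniq (Tmasks t) by rewrite filter_uniq ?uniq_bitseqs.
move=> t3; rewrite card_mask_family // undup_id // sum_containing_mask_family //.
by rewrite -TsizesE -ToccurrencesE !nth_mkseq.
Qed.

(* The weights are the unique solution of the seven equations, which are
   invariant under the symmetric group on {0, 1, 2} and the swap (3 5)(4 6). *)
Lemma Bfam_equations_solvable (R : realType) :
  exists y : 'rV[R]_7,
    [/\ forall i : 'I_7, 0 <= y ord0 i,
        \sum_(i < 7) y ord0 i <= 1
      & forall j : 'I_7,
          \sum_(i < 7) y ord0 i * #|containing (Bfam A7 j) i|%:R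
          = #|Bfam A7 j|%:R / 2].
Proof.
pose a : R := 2179 / 18 / 1909; pose b : R := 2932 / 9 / 1909.
pose c : R := 4022 / 9 / 1909.
exists (\row_i nth 0 [:: a; a; a; b; c; b; c] i); split=> [i||j].
- by rewrite mxE; case: i => [[|[|[|[|[|[|[|i]]]]]]] lti] //=;
     rewrite /a /b /c; lra.
- by rewrite !big_ord_recl big_ord0 !mxE /= /a /b /c; lra.
have [-> ->] := Bfam_counts R (\row_i nth 0 [:: a; a; a; b; c; b; c] i) j.
rewrite !big_ord_recl big_ord0 !mxE.
by case: j => [[|[|[|[|[|[|[|j]]]]]]] ltj] //=; rewrite /a /b /c; lra.
Qed.

(** Seven inequalities already conflict. Subtracting half the size times the total weight 1 makes
    them homogeneous: those on T add up to minus the weight of T being nonnegative, and the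
    combination of the B^(j) has coefficients -6 on 3, 5 and -3 on 4, 6. *)
Lemma polyhedron_A7 (R : realType) : polyhedron R A7 = classical_sets.set0.
Proof.
apply/seteqP; split=> // y [y_ge0 y1 yB].
have ByE j (j7 : (j < 7)%N) : (nth 0%N Bsizes j)%:R / 2 <=
    \sum_(i < 7) y ord0 i * (nth 0%N (nth [::] Boccurrences j) i)%:R.
  have [<- <-] := Bfam_counts R y (Ordinal j7).
  exact: yB (UC_Bfam _ _ UC_A7 _) (uplus_Bfam _ _ UC_A7 _ set0_A7).
have TyE t (t3 : (t < 3)%N) : (nth 0%N [:: 48; 48; 48]%N t)%:R / 2 <=
    \sum_(i < 7) y ord0 i * (nth 0%N (nth [::] Toccurrences t) i)%:R.
  have [<- <-] := Tmasks_counts R y t t3.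
  exact: yB (UC_Tmasks t t3) (uplus_Tmasks t t3).
(* Indexing by naturals lets the sums unfold to seven explicit terms, whose weights become plain
   variables for [lra]. *)
pose z k := y ord0 (inord k).
have z_ge0 k : 0 <= z k := y_ge0 _.
have yzE (f : nat -> R) :
    \sum_(i < 7) y ord0 i * f i = \sum_(0 <= k < 7) z k * f k.
  by rewrite big_mkord; apply: eq_bigr => i _; rewrite /z inord_val.
have z1 : \sum_(0 <= k < 7) z k = 1.
  by rewrite big_mkord -y1; apply: eq_bigr => i _; rewrite /z inord_val.
move: z1 (TyE 0%N isT) (TyE 1%N isT) (TyE 2%N isT).
move: (ByE 3%N isT) (ByE 4%N isT) (ByE 5%N isT) (ByE 6%N isT).
move: (z_ge0 0%N) (z_ge0 1%N) (z_ge0 2%N) (z_ge0 3%N) (z_ge0 4%N) (z_ge0 5%N).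
move: (z_ge0 6%N).
rewrite !(yzE (fun i => (nth 0%N _ i)%:R)) /index_iota unlock /=.
(* The three T-inequalities force [z] to vanish on {0, 1, 2}; then
   [2 * (B_3 + B_5) + 5 * (B_4 + B_6)] has only negative coefficients. *)
move: (z 0%N) (z 1%N) (z 2%N) (z 3%N) (z 4%N) (z 5%N) (z 6%N) => *.
lra.
Qed.

Theorem corollary7 (R : realType) :
  exists (n : nat) (A : {set {set 'I_n}}),
    [/\ (1 <= n)%N,
        UC A,
        finset.cover A = [set: 'I_n]%SET
      & finset.set0 \in A] /\
    (exists y : 'rV[R]_n,
       [/\ forall i : 'I_n, 0 <= y ord0 i,
           \sum_(i < n) y ord0 i <= 1
         & forall j : 'I_n,
             \sum_(i < n) y ord0 i * #|containing (Bfam A j) i|%:R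
             = #|Bfam A j|%:R / 2]) /\
    polyhedron R A = classical_sets.set0.
Proof.
exists 7%N, A7; split.
  by split=> //; [exact: UC_A7 | exact: cover_A7 | exact: set0_A7].
by split; [exact: Bfam_equations_solvable | exact: polyhedron_A7].
Qed.
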